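(* Define the tradeoff filter $\bar F(s)=\left(1+L_{est}^{aug}(s)\right)^{-1}$, where $L_{est}^{aug}(s)$ denotes the transfer function from the measured estimation error $\tilde w_N^m$ to $\hat w_N$ in the observer, given by $$L_{est}^{aug}(s)=C_{aug}(sI_{n+N}-A_{aug})^{-1}L_{aug}=P_N(s)C(sI_n-A)^{-1}L_1+C_N(sI_N-A_N)^{-1}L_2 .$$ Then the estimation error $\tilde w_N=w-\hat w_N$ satisfies $$\tilde W_N(s)=\bar F(s)\left(\Delta(s)G(s)U(s)+e^{-s\tau}G_d(s)D(s)\right)+\left(\bar F(s)-1\right)N(s),$$ where $\Delta(s)=e^{-s\tau}-P_N(s)$.
   Context: Let $n,N\ge1$ be integers, $\tau>0$, $A\in\mathbb{R}^{n\times n}$, $B,E\in\mathbb{R}^{n\times1}$, $C\in\mathbb{R}^{1\times n}$, with $(A,C)$ observable and $(A,B)$, $(A,E)$ controllable. The plant is $\dot x=Ax+Bu+Ed$, $y=Cx$, with scalar input $u$, scalar disturbance $d$, scalar output $y$. Put $G(s)=C(sI_n-A)^{-1}B$, $G_d(s)=C(sI_n-A)^{-1}E$. The delayed output is $w(t)=y(t-\tau)$ and its measurement is $w^m=w+n$, with $n$ a scalar measurement noise signal (Laplace transform denoted $N(s)$; not to be confused with the dimensions $n$, $N$). $P_N(s)$ denotes the $N$-th order (diagonal) Padé approximation of $e^{-s\tau}$: $P_N(s)=Q_N(-s)/Q_N(s)$ with $Q_N(s)=\sum_{k=0}^N\frac{(2N-k)!\,N!}{(2N)!\,k!\,(N-k)!}(\tau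 s)^k$, with minimal realization $P_N(s)=C_N(sI_N-A_N)^{-1}B_N+D_N$. Define $$A_{aug}=\begin{bmatrix}A&0_{n\times N}\\ B_NC&A_N\end{bmatrix},\ B_{aug}=\begin{bmatrix}B\\ 0_{N\times1}\end{bmatrix},\ C_{aug}=\begin{bmatrix}D_NC&C_N\end{bmatrix},\ L_{aug}=\begin{bmatrix}L_1\\ L_2\end{bmatrix},$$ with estimator gains $L_1\in\mathbb{R}^n$, $L_2\in\mathbb{R}^N$. The observer is $$\dot{\hat x}_{aug}=A_{aug}\hat x_{aug}+B_{aug}u+L_{aug}\tilde w_N^m,\qquad \hat w_N=C_{aug}\hat x_{aug},\qquad \tilde w_N^m=w^m-\hat w_N,$$ with $\hat x_{aug}=[\hat x^T\ \hat q_N^T]^T$, and the control law is $u=-K\hat x+Hr$, with $K\in\mathbb{R}^{1\times n}$, scalar $H$ and scalar reference $r$. Capital letters $U(s),D(s),N(s),\tilde W_N(s)$, etc. denote Laplace transforms of the corresponding signals, all initial conditions being zero (and $y(t)=0$ for $t<0$). *)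

(* Defs.v *)
From HB Require Import structures.
From mathcomp Require Import all_boot all_order all_algebra.
From mathcomp Require Import complex.
From mathcomp Require Import all_classical all_reals all_analysis.

Set Implicit Arguments.
Unset Strict Implicit.
Unset Printing Implicit Defensive.

Import Order.TTheory GRing.Theory Num.Theory.
Import numFieldNormedType.Exports.

Local Open Scope classical_set_scope.
Local Open Scope ring_scope.
Local Open Scope complex_scope.

Section LinearSystems.
Variable R : realType.

Definition cplx_mx m n (M : 'M[R]_(m, n)) : 'M[R[i]]_(m, n) :=
  map_mx (real_complex R) M.

(* s I - A over the complex numbers; s is an eigenvalue of A exactly when this
   matrix is not in unitmx, in which case invmx and transfer are junk. *)
Definition char_mx_at n (A : 'M[R]_n) (s : R[i]) : 'M[R[i]]_n :=
  s%:M - cplx_mx A.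

(* C (sI - A)^-1 B, for one input and one output *)
Definition transfer n (A : 'M[R]_n) (B : 'cV[R]_n) (C : 'rV[R]_n) (s : R[i]) :
    R[i] :=
  (cplx_mx C *m invmx (char_mx_at A s) *m cplx_mx B) 0 0.

(* rank [B, AB, ..., A^(n-1) B] = n *)
Definition controllable n (A : 'M[R]_n) (B : 'cV[R]_n) : bool :=
  \rank (\matrix_(i < n, j < n) (A ^+ j *m B) i 0) == n.

(* rank [C; CA; ...; C A^(n-1)] = n *)
Definition observable n (A : 'M[R]_n) (C : 'rV[R]_n) : bool :=
  \rank (\matrix_(i < n, j < n) (C *m A ^+ i) 0 j) == n.

End LinearSystems.

Section Pade.
Variable R : realType.

Definition pade_den (N : nat) (tau : R) : {poly R} :=
  \poly_(k < N.+1)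
    ((((2 * N - k)`! * N`!)%N%:R / ((2 * N)`! * k`! * (N - k)`!)%N%:R)
      * tau ^+ k).

Definition pade_den_at (N : nat) (tau : R) (s : R[i]) : R[i] :=
  (map_poly (real_complex R) (pade_den N tau)).[s].

Definition pade (N : nat) (tau : R) (s : R[i]) : R[i] :=
  pade_den_at N tau (- s) / pade_den_at N tau s.

(* Equality of rational functions, tested wherever both sides are defined. *)
Definition pade_realization (N : nat) (tau : R) m
    (A : 'M[R]_m) (B : 'cV[R]_m) (C : 'rV[R]_m) (D : R) : Prop :=
  forall s : R[i], pade_den_at N tau s != 0 -> char_mx_at A s \in unitmx ->
    pade N tau s = transfer A B C s + D%:C.

Definition minimal_pade_realization (N : nat) (tau : R) m
    (A : 'M[R]_m) (B : 'cV[R]_m) (C : 'rV[R]_m) (D : R) : Prop :=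
  pade_realization N tau A B C D /\
  forall m' (A' : 'M[R]_m') (B' : 'cV[R]_m') (C' : 'rV[R]_m') (D' : R),
    pade_realization N tau A' B' C' D' -> (m <= m')%N.

End Pade.

Section Observer.
Variables (R : realType) (n N : nat).

Definition A_aug (A : 'M[R]_n) (C : 'rV[R]_n) (AN : 'M[R]_N) (BN : 'cV[R]_N) :
    'M[R]_(n + N) :=
  block_mx A 0 (BN *m C) AN.

Definition B_aug (B : 'cV[R]_n) : 'cV[R]_(n + N) := col_mx B 0.

Definition C_aug (C : 'rV[R]_n) (CN : 'rV[R]_N) (DN : R) : 'rV[R]_(n + N) :=
  row_mx (DN *: C) CN.

Definition L_aug (L1 : 'cV[R]_n) (L2 : 'cV[R]_N) : 'cV[R]_(n + N) :=
  col_mx L1 L2.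

Definition L_est_aug (A : 'M[R]_n) (C : 'rV[R]_n)
    (AN : 'M[R]_N) (BN : 'cV[R]_N) (CN : 'rV[R]_N) (DN : R)
    (L1 : 'cV[R]_n) (L2 : 'cV[R]_N) (s : R[i]) : R[i] :=
  transfer (A_aug A C AN BN) (L_aug L1 L2) (C_aug C CN DN) s.

Definition tradeoff_filter (A : 'M[R]_n) (C : 'rV[R]_n)
    (AN : 'M[R]_N) (BN : 'cV[R]_N) (CN : 'rV[R]_N) (DN : R)
    (L1 : 'cV[R]_n) (L2 : 'cV[R]_N) (s : R[i]) : R[i] :=
  (1 + L_est_aug A C AN BN CN DN L1 L2 s)^-1.

End Observer.

Section Signals.
Variable R : realType.
Local Notation mu := (@lebesgue_measure R).

Definition cexp (z : R[i]) : R[i] :=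
  (expR (complex.Re z) * cos (complex.Im z))
  +i* (expR (complex.Re z) * sin (complex.Im z)).

(* The Laplace integral of f converges absolutely at s
   (recall |e^(-st)| = e^(-t Re s)). *)
Definition laplace_converges (f : R -> R) (s : R[i]) : Prop :=
  mu.-integrable `[0, +oo[ (fun t => (f t * expR (- (complex.Re s * t)))%:E).

(* One-sided Laplace transform: the integral of f(t) e^(-st) over [0, +oo[,
   computed on real and imaginary parts. *)
Definition laplace (f : R -> R) (s : R[i]) : R[i] :=
  (\int[mu]_(t in `[0%R, +oo[)
     complex.Re ((f t)%:C * cexp (- (s * t%:C))))
  +i* (\int[mu]_(t in `[0%R, +oo[)
     complex.Im ((f t)%:C * cexp (- (s * t%:C)))).

(* x is the solution on [0, +oo[ of x' = f with x(0) = 0, in the sense of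
   Caratheodory (f locally integrable), so that input signals may jump.
   Where f is continuous, x' = f holds in the usual sense. *)
Definition solves_from_rest n (x f : R -> 'cV[R]_n) : Prop :=
  forall t : R, 0 <= t -> forall i : 'I_n,
    mu.-integrable `[0, t] (fun v => (f v i 0)%:E) /\
    x t i 0 = \int[mu]_(v in `[0, t]) f v i 0.

Lemma solves_from_rest0 n (x f : R -> 'cV[R]_n) :
  solves_from_rest x f -> x 0 = 0.
Proof.
move=> xf; apply/matrixP => i j; rewrite ord1 mxE.
have [_ ->] := xf 0 (lexx _) i.
by rewrite set_itv1 Rintegral_set1.
Qed.

Lemma solves_from_rest_derive n (x f : R -> 'cV[R]_n) (t : R) (i : 'I_n) :
  solves_from_rest x f -> 0 < t ->
  {for t, continuous (fun v => f v i 0)} ->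
  is_derive t 1 (fun v => x v i 0) (f t i 0).
Proof.
move=> xf t0 cft.
have t1 : t < t + 1 by rewrite ltrDl.
have [intf _] := xf _ (ltW (lt_trans t0 t1)) i.
have [] := continuous_FTC1 (f := fun v => f v i 0) t1 intf _ cft.
  by rewrite /= lte_fin.
rewrite derive1E => dF <-.
have near_x : {near t, (fun z => \int[mu]_(v in `[0, z]) f v i 0)
    =1 (fun v => x v i 0)}.
  near=> z; have z0 : 0 <= z.
    by apply: ltW; near: z; exact: lt_nbhsr.
  by have [_ ->] := xf _ z0 i.
by split; [exact: near_eq_derivable dF|rewrite -(near_eq_derive _ near_x)].
Unshelve. all: by end_near. Qed.

End Signals.

(* Main.v *)
Require Import Defs.
From HB Require Import structures.
From mathcomp Require Import all_boot all_order all_algebra.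
From mathcomp Require Import complex.
From mathcomp Require Import all_classical all_reals all_analysis.
From mathcomp Require Import measurable_realfun ring.

Set Implicit Arguments.
Unset Strict Implicit.
Unset Printing Implicit Defensive.

Import Order.TTheory GRing.Theory Num.Theory.
Import numFieldNormedType.Exports.

Local Open Scope classical_set_scope.
Local Open Scope ring_scope.
Local Open Scope complex_scope.

(** The identity is linear algebra in the Laplace domain, once the transform is
    shown to turn the signal equations into algebraic ones at the given point s.

    Three properties of the transform are used.  It is linear.  It multiplies by
    e^(-s tau) under a delay of tau of a signal that vanishes before time 0
    ([laplace_delay]), because Lebesgue measure is invariant under translation.
    And f = x' with x(0) = 0 gives F(s) = s X(s) ([laplace_from_rest]).

    The last rule needs care on two counts.  The signals are only Caratheodory
    solutions, so x is the indefinite integral of a locally integrable f and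
    integration by parts against the smooth kernel e^(-st) is obtained from
    Fubini's theorem on the triangle 0 <= v <= t <= T
    ([integral_by_parts_from_rest]).  And no sign is imposed on Re s, so the
    boundary term x(T) e^(-sT) is not bounded a priori; however it is an
    integrable function of T, hence it tends to 0 along some sequence of times
    going to infinity, and this is enough ([integral_by_parts_halfline]).

    Consequently a system x' = A x + p B + q E has output transform
    C (sI - A)^-1 (B P(s) + E Q(s)) ([laplace_output]).  Applied to the plant and
    to the observer this gives W and What; the block triangular shape of the
    augmented matrix expresses the transfer functions of the observer through
    those of its two blocks ([transfer_aug]), so that What = P G U + Lest (Wtilde
    + N).  Solving this feedback equation for Wtilde = W - What
    ([feedback_error]) yields the formula, with P G U subtracted from
    e^(-s tau) G U, which is where Delta comes from. *)

Local Notation mu := lebesgue_measure.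

(** * Integration by parts for an indefinite integral *)

Lemma EFin_Rintegral d (T : measurableType d) (R : realType)
    (m : {measure set T -> \bar R}) (D : set T) (f : T -> R) :
  measurable D -> m.-integrable D (EFin \o f) ->
  (\int[m]_(t in D) f t)%:E = (\int[m]_(t in D) (f t)%:E)%E.
Proof. by move=> mD fi; rewrite /Rintegral fineK//; exact: integrable_fin_num. Qed.

Lemma integrableM_bounded d (T : measurableType d) (R : realType)
    (m : {measure set T -> \bar R}) (D : set T) (f h : T -> R) :
  measurable D -> m.-integrable D (EFin \o f) ->
  measurable_fun D h -> [bounded h t | t in D] ->
  m.-integrable D (EFin \o (fun t => f t * h t)).
Proof.
by move=> mD fi mh bh; apply: eq_integrable (integrableMl mD fi mh bh).
Qed.

Lemma is_derive_continuous (R : realType) (phi psi : R -> R) :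
  (forall t : R, is_derive t 1 phi (psi t)) -> continuous phi.
Proof.
move=> dphi t; apply/differentiable_continuous/derivable1_diffP.
exact: (@ex_derive _ _ _ _ _ _ _ (dphi t)).
Qed.

Lemma integral_is_derive (R : realType) (phi psi : R -> R) (a b : R) : a <= b ->
  (forall t : R, is_derive t 1 phi (psi t)) -> continuous psi ->
  (\int[mu]_(t in `[a, b]) (psi t)%:E)%E = (phi b - phi a)%:E.
Proof.
move=> + dphi cpsi; rewrite le_eqVlt => /predU1P[->|ab].
  by rewrite set_itv1 integral_set1 subrr.
rewrite (@continuous_FTC2 _ psi phi)//.
- exact: continuous_subspaceT.
- have cphi := is_derive_continuous dphi.
  split; [by move=> t _; exact: (@ex_derive _ _ _ _ _ _ _ (dphi t))| |].
    exact/cvg_at_right_filter/cphi.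
  exact/cvg_at_left_filter/cphi.
- by move=> t _; rewrite derive1E; exact: (@derive_val _ _ _ _ _ _ _ (dphi t)).
Qed.

Lemma continuous_measurable_funTS (R : realType) (f : R -> R) (D : set R) :
  measurable D -> continuous f -> measurable_fun D f.
Proof.
move=> mD cf; apply: (@measurable_funS _ _ _ _ setT) => //.
exact: continuous_measurable_fun.
Qed.

Lemma continuous_bounded_itv (R : realType) (f : R -> R) (T : R) :
  continuous f -> [bounded f t | t in `[0, T]].
Proof.
move=> cf.
have cfT : compact (f @` `[0, T]).
  apply: continuous_compact; last exact: segment_compact.
  exact: continuous_subspaceT.
have [M [Mreal fM]] := compact_bounded cfT.
by exists M; split=> // B MB t tT; apply: (fM B MB); exists t.
Qed.

(** Fubini's theorem for f(v) psi(t) on the triangle 0 <= v <= t <= T: integrating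
    first over v gives x(t) psi(t), first over t gives f(v) (phi(T) - phi(v)).
    As f is only integrable, x need not be differentiable everywhere. *)
Lemma integral_by_parts_from_rest (R : realType) (f x phi psi : R -> R) (T : R) :
  0 <= T -> mu.-integrable `[0, T] (EFin \o f) ->
  (forall t : R, t \in `[0, T] -> x t = \int[mu]_(v in `[0, t]) f v) ->
  (forall t : R, is_derive t 1 phi (psi t)) -> continuous psi ->
  \int[mu]_(t in `[0, T]) (x t * psi t) =
  x T * phi T - \int[mu]_(t in `[0, T]) (f t * phi t).
Proof.
move=> T0 fi xE dphi cpsi.
have cphi := is_derive_continuous dphi.
have [M [_ psiM]] := continuous_bounded_itv T cpsi.
pose B : R := `|M| + 1.
have psiB (t : R) : t \in `[0, T] -> `|psi t| <= B.
  by move=> tT; apply: psiM => //; rewrite /B (le_lt_trans (ler_norm M))// ltrDl.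
have B0 : 0 <= B by rewrite addr_ge0.
(* the integrand, cut off outside the triangle *)
pose g (z : measurableTypeR R * measurableTypeR R) : R :=
  (f \_ `[0, T]) z.1 * ((psi \_ `[0, T]) z.2 * \1_[set z | z.1 <= z.2] z).
have mg : measurable_fun setT g.
  apply: measurable_funM.
    apply: (measurableT_comp (f := f \_ `[0, T])) => //.
    apply: (measurable_restrictT _ _).1 => //.
    by have /measurable_EFinP := measurable_int mu fi.
  apply: measurable_funM.
    apply: (measurableT_comp (f := psi \_ `[0, T])) => //.
    apply: (measurable_restrictT _ _).1 => //.
    exact: continuous_measurable_funTS.
  apply: measurable_indic.
  rewrite -[X in measurable X]setTI.
  exact: measurable_fun_le.
have ig : (mu \x mu)%E.-integrable setT (EFin \o g).
  apply/integrable12ltyP; first exact/measurable_EFinP.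
  (* Tonelli: the inner integral of |g| is at most |f v| B T *)
  have bound v : (\int[mu]_t `|(g (v, t))%:E| <=
      ((fun v => (`|f v| * (B * T))%:E) \_ `[0%R, T]) v)%E.
    rewrite patchE; case: ifPn => vT; last first.
      rewrite integral0_eq// => t _.
      by rewrite /g /= patchE (negbTE vT) mul0r normr0.
    apply: (@le_trans _ _ (\int[mu]_(t in `[0%R, T]) (`|f v| * B)%:E)%E).
      rewrite [leRHS]integral_mkcond; apply: ge0_le_integral => //.
      - apply: measurableT_comp => //; apply/measurable_EFinP.
        exact: (measurableT_comp mg (pair1_measurable v)).
      - apply: (measurable_restrictT _ _).1 => //; exact: measurable_cst.
      move=> t _; rewrite /g /= !patchE vT; case: ifPn => tT; last first.
        by rewrite mul0r mulr0 normr0.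
      rewrite lee_fin !normrM ler_wpM2l// -[leRHS]mulr1 ler_pM//.
        by apply: psiB; rewrite inE in tT.
      by rewrite indicE; case: (_ \in _); rewrite ?normr0 ?normr1.
    rewrite integral_cst//= lebesgue_measure_itv/= lte_fin.
    case: ltP => _; first by rewrite oppr0 addr0 -EFinM mulrA.
    by rewrite mule0 lee_fin !mulr_ge0.
  have mI : measurable_fun setT (fun v : measurableTypeR R => \int[mu]_t `|(g (v, t))%:E|)%E.
    apply: (measurable_fun_fubini_tonelli_F (m2 := mu) (abse \o (EFin \o g))) => [|z].
      by apply: measurableT_comp => //; exact/measurable_EFinP.
    exact: abse_ge0.
  have bi : mu.-integrable `[0%R, T] (fun v => (`|f v| * (B * T))%:E).
    rewrite (_ : (fun _ => _) = fun v => ((B * T)%:E * (EFin \o (Num.norm \o f)) v)%E).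
      by apply: integrableZl => //; exact: integrable_norm.
    by apply/funext => v; rewrite /= mulrC EFinM.
  apply: (@le_lt_trans _ _ (\int[mu]_(v in `[0%R, T]) (`|f v| * (B * T))%:E)%E).
    rewrite [leRHS]integral_mkcond; apply: ge0_le_integral => //.
    - by move=> v _; exact: integral_ge0.
    - apply: (measurable_restrictT _ _).1 => //; exact: measurable_int bi.
    - by move=> v _; exact: bound.
  by apply: integrable_lty => //; exact: bi.
have gE (v t : R) : g (v, t) = (f \_ `[0, T]) v * ((psi \_ `[0, T]) t * (v <= t)%R%:R).
  by rewrite /g /= indicE; congr (_ * (_ * _%:R)); congr nat_of_bool;
    apply/idP/idP; rewrite inE.
have inner1 (v : R) : (\int[mu]_t (g (v, t))%:E)%E =
    (((fun v => f v * (phi T - phi v)) \_ `[0, T]) v)%:E.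
  rewrite !patchE; case: ifPn => vT; last first.
    by under eq_integral do rewrite /g /= patchE (negbTE vT) mul0r; rewrite integral0.
  have [v0 vleT] : 0 <= v /\ v <= T.
    by move: vT; rewrite inE/= in_itv/= => /andP.
  transitivity (\int[mu]_(t in `[v, T]) ((f v)%:E * (psi t)%:E))%E.
    rewrite [RHS]integral_mkcond; apply: eq_integral => t _.
    rewrite gE !patchE vT !mem_setE !in_itv/=.
    have [vt|tv] := leP v t; last by rewrite !mulr0.
    by rewrite (le_trans v0 vt)/= mulr1; case: ifP => // _; rewrite mulr0.
  rewrite integralZl//; last first.
    apply: continuous_compact_integrable; first exact: segment_compact.
    exact: continuous_subspaceT.
  by rewrite (integral_is_derive vleT dphi cpsi).
have inner2 (t : R) : (\int[mu]_v (g (v, t))%:E)%E =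
    (((fun t => x t * psi t) \_ `[0, T]) t)%:E.
  rewrite !patchE; case: ifPn => tT; last first.
    under eq_integral do rewrite /g /= !patchE (negbTE tT) mul0r mulr0.
    by rewrite integral0.
  have [t0 tleT] : 0 <= t /\ t <= T.
    by move: tT; rewrite inE/= in_itv/= => /andP.
  have fit : mu.-integrable `[0, t] (EFin \o f).
    apply: integrableS fi => //; apply: subset_itvl; exact: tleT.
  transitivity (\int[mu]_(v in `[0%R, t]) ((f v)%:E * (psi t)%:E))%E.
    rewrite [RHS]integral_mkcond; apply: eq_integral => v _.
    rewrite gE !patchE tT !mem_setE !in_itv/=.
    have [vt|tv] := leP v t; last by rewrite !mulr0 andbF.
    by rewrite (le_trans vt tleT) andbT mulr1; case: ifP => // _; rewrite mul0r.
  rewrite integralZr// EFinM xE ?EFin_Rintegral//.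
  by rewrite in_itv/= t0.
have <- : \int[mu]_(v in `[0, T]) (f v * (phi T - phi v)) =
          \int[mu]_(t in `[0, T]) (x t * psi t).
  rewrite [LHS]Rintegral_mkcond [RHS]Rintegral_mkcond /Rintegral.
  under eq_integral do rewrite -inner1.
  under [in RHS]eq_integral do rewrite -inner2.
  by rewrite (Fubini ig).
under eq_Rintegral do rewrite mulrBr.
rewrite RintegralB//.
- by rewrite RintegralZr// xE// in_itv/= lexx T0.
- by apply: integrableM_bounded => //; exact: bounded_cst.
- apply: integrableM_bounded => //; last exact: continuous_bounded_itv.
  exact: continuous_measurable_funTS.
Qed.

(** * Integration by parts on the half-line *)

Lemma integrable_measurable_fun d (T : measurableType d) (R : realType)
    (m : {measure set T -> \bar R}) (D : set T) (f : T -> R) :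
  m.-integrable D (EFin \o f) -> measurable_fun D f.
Proof. by move=> /measurable_int/measurable_EFinP. Qed.

Lemma Rintegral_itv0y_cvg (R : realType) (h : R -> R) (u : R ^nat) :
  mu.-integrable `[0, +oo[ (EFin \o h) -> u n @[n --> \oo] --> +oo ->
  \int[mu]_(t in `[0, u n]) h t @[n --> \oo] --> \int[mu]_(t in `[0, +oo[) h t.
Proof.
move=> hi uy; have mh := integrable_measurable_fun hi.
have sub n : `[0, u n] `<=` `[0, +oo[ by apply: subset_itvl; rewrite bnd_simp.
under eq_cvg => n do rewrite -(setIidr (sub n)) Rintegral_mkcondr.
rewrite /Rintegral; apply: fine_cvg.
rewrite fineK; last exact: integrable_fin_num.
have [] // := @dominated_convergence _ _ R mu `[0, +oo[ (measurable_itv _)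
  (fun n t => ((h \_ `[0, u n]) t)%:E) (EFin \o h) (fun t => `|h t|%:E).
- move=> n; apply/measurable_EFinP/measurable_restrict => //.
  exact: measurable_funS mh.
- exact/measurable_EFinP.
- apply/aeW => t; rewrite /= in_itv/= andbT => t0.
  apply: cvg_near_cst; near=> n.
  rewrite patchE mem_setE in_itv/= t0/= ifT//.
  by near: n; move/cvgryPge : uy; exact.
- exact: integrable_norm.
- apply/aeW => t n _; rewrite lee_fin patchE; case: ifPn => // _.
  by rewrite normr0.
Unshelve. all: by end_near. Qed.

(** If no such sequence existed, |g| would stay above a positive constant from
    some time on, and its integral would be infinite. *)
Lemma integrable_vanishing_seq (R : realType) (g : R -> R) :
  mu.-integrable `[0, +oo[ (EFin \o g) ->
  exists2 u : R ^nat, forall n, n%:R <= u n & g (u n) @[n --> \oo] --> 0.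
Proof.
move=> gi.
have small (n : nat) : exists t : R, n%:R <= t /\ `|g t| <= n.+1%:R^-1.
  apply: contrapT => /forallNP H.
  have sub : `[n%:R, +oo[ `<=` `[(0 : R), +oo[.
    by apply: subset_itvr; rewrite bnd_simp.
  have gin : mu.-integrable `[n%:R, +oo[ (EFin \o g) by exact: integrableS gi.
  have /integrableP[_] := gin; apply/negP; rewrite -leNgt.
  apply: (@le_trans _ _ (\int[mu]_(t in `[n%:R, +oo[) (n.+1%:R^-1)%:E)%E).
    rewrite integral_cst//= lebesgue_measure_itv/=.
    by rewrite ltry addye// gt0_muley// lte_fin invr_gt0.
  apply: ge0_le_integral => //.
  - apply: measurableT_comp => //; exact: measurable_int gin.
  - move=> t /=; rewrite in_itv/= andbT => nt.
    rewrite lee_fin leNgt; apply/negP => tn.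
    by apply: (H t); split => //; exact: ltW.
have [u uP] := choice small.
exists u => [n|]; first by have [] := uP n.
apply/cvgr0Pnorm_le => e e0; near=> n.
have [_ /le_trans] := uP n; apply.
by apply: ltW; near: n; exact: (near_infty_natSinv_lt (PosNum e0)).
Unshelve. all: by end_near. Qed.

(** The boundary term x phi is only assumed integrable: it vanishes along a
    sequence of times u n, and the integrals over [0, u n] converge. *)
Lemma integral_by_parts_halfline (R : realType) (f x phi psi : R -> R) :
  (forall t : R, 0 <= t -> mu.-integrable `[0, t] (EFin \o f)) ->
  (forall t : R, 0 <= t -> x t = \int[mu]_(v in `[0, t]) f v) ->
  (forall t : R, is_derive t 1 phi (psi t)) -> continuous psi ->
  mu.-integrable `[0, +oo[ (EFin \o (fun t => f t * phi t)) ->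
  mu.-integrable `[0, +oo[ (EFin \o (fun t => x t * psi t)) ->
  mu.-integrable `[0, +oo[ (EFin \o (fun t => x t * phi t)) ->
  \int[mu]_(t in `[0, +oo[) (f t * phi t) =
  - \int[mu]_(t in `[0, +oo[) (x t * psi t).
Proof.
move=> fi xE dphi cpsi ifphi ixpsi ixphi.
have [u un xu0] := integrable_vanishing_seq ixphi.
have uy : u n @[n --> \oo] --> +oo.
  apply/cvgryPge => a; near=> n; rewrite (le_trans _ (un n))//.
  near: n; exact: nbhs_infty_ger.
have := cvgD (Rintegral_itv0y_cvg ixpsi uy) (Rintegral_itv0y_cvg ifphi uy).
have <- : (fun n => x (u n) * phi (u n)) =
    (fun n => \int[mu]_(t in `[0, u n]) (x t * psi t)) +
    (fun n => \int[mu]_(t in `[0, u n]) (f t * phi t)).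
  apply/funext => n; rewrite /GRing.add /=.
  have u0 : 0 <= u n by rewrite (le_trans _ (un n)).
  rewrite (integral_by_parts_from_rest u0 (fi _ u0) _ dphi cpsi) ?subrK// => t.
  by rewrite in_itv/= => /andP[t0 _]; exact: xE.
move=> /(_ _)/cvg_lim lim_sum; have /eqP := lim_sum (@Rhausdorff _).
by rewrite (cvg_lim (@Rhausdorff _) xu0) eq_sym addrC addr_eq0 => /eqP.
Unshelve. all: by end_near. Qed.

(** * Translation of Lebesgue integrals *)

Lemma measurable_shift (R : realType) (c : R) : measurable_fun setT
  ((fun t => t + c) : measurableTypeR R -> measurableTypeR R).
Proof. by apply: measurable_funD => //; exact: measurable_cst. Qed.

(** A measure on the line is determined by its values on the intervals ]a, b]. *)
Lemma lebesgue_measure_shift (R : realType) (c : R) (A : set (measurableTypeR R)) :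
  measurable A ->
  pushforward mu ((fun t => t + c) : _ -> measurableTypeR R) A = mu A.
Proof.
move=> mA; apply/esym.
apply: (@lebesgue_measure_unique R
  (measure_function_pushforward__canonical__measure_function_Measure mu
    (measurable_shift c))) => //.
move=> X [[a b]] _ <-.
rewrite /= /pushforward /=.
have -> : (fun t : R => t + c) @^-1` `]a, b] = `](a - c), (b - c)]%classic.
  by apply/seteqP; split=> t /=; rewrite !in_itv/= ltrBlDr lerBrDr.
rewrite !lebesgue_measure_itv/= !lte_fin ltrD2r; case: ifP => // _.
by rewrite -!EFinB opprB addrA subrK.
Qed.

Lemma integrable_shift (R : realType) (h : R -> \bar R) (c : R) :
  mu.-integrable setT h -> mu.-integrable setT (fun t => h (t + c)).
Proof.
move=> /integrableP[mh hi]; apply/integrableP; split.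
  exact: (measurableT_comp mh (measurable_shift c)).
apply: le_lt_trans hi.
have := @ge0_integral_pushforward _ _ _ _ R _ (measurable_shift c) mu setT
  (abse \o h) measurableT.
rewrite preimage_setT /= => <- //.
  rewrite le_eqVlt; apply/orP; left; apply/eqP.
  apply: eq_measure_integral => [|? A mA _]; first exact: measurable_shift.
  exact: lebesgue_measure_shift.
exact: measurableT_comp.
Qed.

Lemma integral_shift (R : realType) (h : R -> \bar R) (c : R) :
  mu.-integrable setT h -> (\int[mu]_t h (t + c)%R = \int[mu]_t h t)%E.
Proof.
move=> hi; have mh := measurable_int mu hi.
transitivity (\int[pushforward mu ((fun t => t + c)%R : _ -> measurableTypeR R)]_t h t)%E.
  by rewrite (integral_pushforward (measurable_shift c))//=; exact: integrable_shift.
apply: eq_measure_integral => [|? A mA _]; first exact: measurable_shift.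
exact: lebesgue_measure_shift.
Qed.

Section delay.
Variables (R : realType) (h : R -> R) (tau : R).
Hypotheses (tau0 : 0 <= tau) (h0 : forall t, t < 0 -> h t = 0).
Hypothesis hi : mu.-integrable `[0, +oo[ (EFin \o h).

Lemma restrict_causal (k : R -> R) : (forall t, t < 0 -> k t = 0) ->
  (EFin \o k) \_ `[0%R, +oo[ = EFin \o k.
Proof.
move=> k0; apply/funext => t; rewrite patchE mem_setE in_itv/= andbT.
by case: ifPn => //; rewrite -ltNge => /k0 ->.
Qed.

Let delay0 t : t < 0 -> h (t - tau) = 0.
Proof. by move=> t0; apply: h0; rewrite subr_lt0 (lt_le_trans t0). Qed.

Let hiT : mu.-integrable setT (EFin \o h).
Proof. by move/integrable_mkcond : hi; rewrite restrict_causal//; exact. Qed.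

Lemma integrable_delay :
  mu.-integrable `[0, +oo[ (EFin \o (fun t => h (t - tau))).
Proof.
apply/integrable_mkcond => //; rewrite restrict_causal//.
exact: (integrable_shift (- tau) hiT).
Qed.

Lemma Rintegral_delay :
  \int[mu]_(t in `[0, +oo[) h (t - tau) = \int[mu]_(t in `[0, +oo[) h t.
Proof.
rewrite /Rintegral [in LHS]integral_mkcond [in RHS]integral_mkcond.
rewrite [in LHS](restrict_causal delay0) [in RHS](restrict_causal h0).
by rewrite (integral_shift (- tau) hiT).
Qed.
End delay.

(** * The Laplace transform of scalar signals *)

Lemma cexpD (R : realType) (z w : R[i]) : cexp (z + w) = cexp z * cexp w.
Proof.
case: z w => [a b] [c d]; rewrite /cexp /= expRD cosD sinD.
by apply/eqP; rewrite eq_complex /=; apply/andP; split; apply/eqP; ring.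
Qed.

Lemma Rintegral_lincomb d (T : measurableType d) (R : realType)
    (m : {measure set T -> \bar R}) (D : set T) (f g : T -> R) (a b : R) :
  measurable D -> m.-integrable D (EFin \o f) -> m.-integrable D (EFin \o g) ->
  m.-integrable D (EFin \o (fun t => a * f t + b * g t)) /\
  \int[m]_(t in D) (a * f t + b * g t) =
  a * \int[m]_(t in D) f t + b * \int[m]_(t in D) g t.
Proof.
move=> mD fi gi.
have afi := integrableZl mD a fi; have bgi := integrableZl mD b gi.
split; first exact: (integrableD mD afi bgi).
by rewrite RintegralD// !RintegralZl.
Qed.

Section kernel.
Variables (R : realType) (s : R[i]).

Definition kernel (t : R) : R[i] := cexp (- (s * t%:C)).

Lemma kernelE t : kernel t =
  (expR (- (complex.Re s * t)) * cos (complex.Im s * t)) +i*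
  (- (expR (- (complex.Re s * t)) * sin (complex.Im s * t))).
Proof.
rewrite /kernel /cexp; case: s => a b /=.
by rewrite !mulr0 subr0 add0r cosN sinN mulrN.
Qed.

Lemma kernelD t v : kernel (t + v) = kernel t * kernel v.
Proof. by rewrite /kernel -cexpD -opprD -mulrDr rmorphD. Qed.

(** The real integrals defining the transform see the kernel k through its two
    parts, for which the equation k' = - s k is a real linear system. *)
Definition kernelRe t := complex.Re (kernel t).
Definition kernelIm t := complex.Im (kernel t).

Lemma kernelReE : kernelRe =
  fun t => expR (- (complex.Re s * t)) * cos (complex.Im s * t).
Proof. by apply/funext => t; rewrite /kernelRe kernelE. Qed.

Lemma kernelImE : kernelIm =
  fun t => expR (- (complex.Re s * t)) * - sin (complex.Im s * t).
Proof. by apply/funext => t; rewrite /kernelIm kernelE /= mulrN. Qed.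

Lemma is_derive_kernelRe (t : R) : is_derive t 1 kernelRe
  (- complex.Re s * kernelRe t + complex.Im s * kernelIm t).
Proof.
rewrite kernelReE kernelImE; apply: is_derive_eq.
by rewrite /GRing.scale /=; ring.
Qed.

Lemma is_derive_kernelIm (t : R) : is_derive t 1 kernelIm
  (- complex.Im s * kernelRe t + - complex.Re s * kernelIm t).
Proof.
rewrite kernelReE kernelImE; apply: is_derive_eq.
by rewrite /GRing.scale /=; ring.
Qed.

Lemma continuous_kernelRe : continuous kernelRe.
Proof. exact: (is_derive_continuous is_derive_kernelRe). Qed.

Lemma continuous_kernelIm : continuous kernelIm.
Proof. exact: (is_derive_continuous is_derive_kernelIm). Qed.

Lemma laplaceE (f : R -> R) : laplace f s =
  (\int[mu]_(t in `[0, +oo[) (f t * kernelRe t)) +i*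
  (\int[mu]_(t in `[0, +oo[) (f t * kernelIm t)).
Proof.
rewrite /laplace; congr (_ +i* _); apply: eq_Rintegral => t _;
  rewrite -/(kernel t) /kernelRe /kernelIm; case: (kernel t) => a b /=;
  by rewrite mul0r ?subr0 ?addr0.
Qed.

Lemma integrable_kernel (f : R -> R) : laplace_converges f s ->
  mu.-integrable `[0, +oo[ (EFin \o (fun t => f t * kernelRe t)) /\
  mu.-integrable `[0, +oo[ (EFin \o (fun t => f t * kernelIm t)).
Proof.
move=> fs; rewrite kernelReE kernelImE.
have bound (h : R -> R) : continuous h -> (forall t, `|h t| <= 1) ->
    mu.-integrable `[0, +oo[
      (EFin \o (fun t => f t * (expR (- (complex.Re s * t)) * h t))).
  move=> ch h1; under [X in EFin \o X]eq_fun do rewrite mulrA.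
  apply: integrableM_bounded => //; first exact: continuous_measurable_funTS.
  by exists 1; split=> // M M1 t _; exact: (le_trans (h1 t) (ltW M1)).
split; apply: bound.
- move=> t; apply: continuous_comp; last exact: continuous_cos.
  exact: mulrl_continuous.
- move=> t; exact: cos_max.
- move=> t; apply: cvgN; apply: continuous_comp; last exact: continuous_sin.
  exact: mulrl_continuous.
- by move=> t; rewrite normrN; exact: sin_max.
Qed.

Lemma continuous_kernel_lincomb (a b : R) :
  continuous (fun t => a * kernelRe t + b * kernelIm t).
Proof.
move=> t; apply: cvgD; apply: cvgM => //; try exact: cvg_cst.
  exact: continuous_kernelRe.
exact: continuous_kernelIm.
Qed.

(** Both multiplying the kernel by - s (differentiation) and shifting it in time
    (delay) produce integrands of this shape. *)
Lemma integral_kernel_lincomb (f : R -> R) (a b : R) : laplace_converges f s ->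
  mu.-integrable `[0, +oo[
    (EFin \o (fun t => f t * (a * kernelRe t + b * kernelIm t))) /\
  \int[mu]_(t in `[0, +oo[) (f t * (a * kernelRe t + b * kernelIm t)) =
  a * complex.Re (laplace f s) + b * complex.Im (laplace f s).
Proof.
move=> /integrable_kernel[fr fi]; rewrite laplaceE /=.
have E : (fun t => f t * (a * kernelRe t + b * kernelIm t)) =
    (fun t => a * (f t * kernelRe t) + b * (f t * kernelIm t)).
  by apply/funext => t; ring.
by rewrite E; apply: Rintegral_lincomb.
Qed.

End kernel.

Lemma complexP (R : realType) (z w : R[i]) :
  complex.Re z = complex.Re w -> complex.Im z = complex.Im w -> z = w.
Proof. by case: z w => [a b] [c d] /= -> ->. Qed.

Section laplace_linear.
Variables (R : realType) (s : R[i]).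

Lemma eq_laplace (f g : R -> R) : (forall t, 0 <= t -> f t = g t) ->
  laplace f s = laplace g s.
Proof.
move=> fg; rewrite !laplaceE; congr (_ +i* _); apply: eq_Rintegral => t;
  by rewrite inE/= in_itv/= andbT => /fg ->.
Qed.

Lemma eq_laplace_converges (f g : R -> R) : (forall t, 0 <= t -> f t = g t) ->
  laplace_converges f s -> laplace_converges g s.
Proof.
move=> fg; apply: eq_integrable => // t.
by rewrite inE/= in_itv/= andbT => /fg ->.
Qed.

Lemma laplace_convergesD (f g : R -> R) :
  laplace_converges f s -> laplace_converges g s ->
  laplace_converges (fun t => f t + g t) s.
Proof.
move=> fs gs; apply: eq_integrable (integrableD _ fs gs) => // t _ /=.
by rewrite mulrDl.
Qed.

Lemma laplaceD (f g : R -> R) :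
  laplace_converges f s -> laplace_converges g s ->
  laplace (fun t => f t + g t) s = laplace f s + laplace g s.
Proof.
move=> /integrable_kernel[fr fi] /integrable_kernel[gr gi].
rewrite !laplaceE; apply: complexP => /=; rewrite -RintegralD//;
  by apply: eq_Rintegral => t _; rewrite mulrDl.
Qed.

Lemma laplace_convergesZ (a : R) (f : R -> R) :
  laplace_converges f s -> laplace_converges (fun t => a * f t) s.
Proof.
move=> fs; apply: eq_integrable (integrableZl _ a fs) => // t _ /=.
by rewrite -EFinM mulrA.
Qed.

Lemma laplaceZ (a : R) (f : R -> R) : laplace_converges f s ->
  laplace (fun t => a * f t) s = a%:C * laplace f s.
Proof.
move=> /integrable_kernel[fr fi].
rewrite !laplaceE; apply: complexP => /=; rewrite mul0r ?subr0 ?addr0 -RintegralZl//;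
    by apply: eq_Rintegral => t _; rewrite -mulrA.
Qed.

Lemma laplace_converges0 : laplace_converges (fun=> 0) s.
Proof.
apply: eq_integrable (integrable0 _ _) => // t _ /=.
by rewrite mul0r.
Qed.

Lemma laplace0 : laplace (fun=> 0) s = 0.
Proof.
have := laplaceZ 0 laplace_converges0.
by rewrite mul0r => ->; exact: mul0r.
Qed.

Lemma laplace_lincomb (I : finType) (a : I -> R) (f : I -> R -> R) :
  (forall i, laplace_converges (f i) s) ->
  laplace_converges (fun t => \sum_i a i * f i t) s /\
  laplace (fun t => \sum_i a i * f i t) s = \sum_i (a i)%:C * laplace (f i) s.
Proof.
move=> fs; elim: (index_enum I) => [|i r [cr lr]].
  under eq_fun do rewrite big_nil; rewrite big_nil laplace0.
  by split => //; exact: laplace_converges0.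
under eq_fun do rewrite big_cons; rewrite big_cons -lr -laplaceZ//.
have ci := laplace_convergesZ (a i) (fs i).
by split; [exact: laplace_convergesD|exact: laplaceD].
Qed.

End laplace_linear.

Section laplace_derivative_delay.
Variables (R : realType) (s : R[i]).

(** Integration by parts against k, where k' = - s k; the boundary term is an
    integrable function, which makes the rule valid for every s at which both
    transforms converge, whatever the sign of Re s. *)
Lemma laplace_from_rest (x f : R -> R) :
  (forall t : R, 0 <= t -> mu.-integrable `[0, t] (EFin \o f)) ->
  (forall t : R, 0 <= t -> x t = \int[mu]_(v in `[0, t]) f v) ->
  laplace_converges x s -> laplace_converges f s ->
  laplace f s = s * laplace x s.
Proof.
move=> fi xE xs /integrable_kernel[frk fik].
have [xrk xik] := integrable_kernel xs.
have [iRe eRe] := integral_kernel_lincomb (- complex.Re s) (complex.Im s) xs.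
have [iIm eIm] := integral_kernel_lincomb (- complex.Im s) (- complex.Re s) xs.
rewrite laplaceE.
rewrite (integral_by_parts_halfline fi xE (is_derive_kernelRe s)
  (@continuous_kernel_lincomb _ s _ _) frk iRe xrk) eRe.
rewrite (integral_by_parts_halfline fi xE (is_derive_kernelIm s)
  (@continuous_kernel_lincomb _ s _ _) fik iIm xik) eIm.
by case: (laplace x s) => p q; case: (s) => a b; apply: complexP => /=; ring.
Qed.

Lemma laplace_converges_delay (y : R -> R) (tau : R) : 0 <= tau ->
  (forall t, t < 0 -> y t = 0) -> laplace_converges y s ->
  laplace_converges (fun t => y (t - tau)) s.
Proof.
move=> tau0 y0 ys.
pose h t := expR (- (complex.Re s * tau)) * (y t * expR (- (complex.Re s * t))).
have h0 t : t < 0 -> h t = 0 by rewrite /h => /y0 ->; rewrite mul0r mulr0.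
have hi : mu.-integrable `[0, +oo[ (EFin \o h).
  by apply: eq_integrable (integrableZl _ (expR (- (complex.Re s * tau))) ys).
apply: eq_integrable (integrable_delay tau0 h0 hi) => // t _ /=.
rewrite /h mulrCA -expRD; congr (_ * expR _)%:E; ring.
Qed.

(** Since k(t + tau) = k(tau) k(t), translating the integral back by tau takes
    out the factor k(tau). *)
Lemma laplace_delay (y : R -> R) (tau : R) : 0 <= tau ->
  (forall t, t < 0 -> y t = 0) -> laplace_converges y s ->
  laplace (fun t => y (t - tau)) s = cexp (- (s * tau%:C)) * laplace y s.
Proof.
move=> tau0 y0 ys; rewrite -/(kernel s tau).
have shift (k : R -> R) (a b : R) :
    (forall t, k (t + tau) = a * kernelRe s t + b * kernelIm s t) ->
    \int[mu]_(t in `[0, +oo[) (y (t - tau) * k t) =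
    a * complex.Re (laplace y s) + b * complex.Im (laplace y s).
  move=> kE; have [hi <-] := integral_kernel_lincomb a b ys.
  pose h t := y t * (a * kernelRe s t + b * kernelIm s t).
  have h0 t : t < 0 -> h t = 0 by rewrite /h => /y0 ->; rewrite mul0r.
  rewrite -(Rintegral_delay tau0 h0 hi); apply: eq_Rintegral => t _.
  by rewrite /h -kE subrK.
rewrite laplaceE (shift _ (complex.Re (kernel s tau)) (- complex.Im (kernel s tau))).
  rewrite (shift _ (complex.Im (kernel s tau)) (complex.Re (kernel s tau))).
    by case: (laplace y s) (kernel s tau) => p q [a b]; apply: complexP => /=; ring.
all: move=> t; rewrite /kernelRe /kernelIm kernelD.
all: by case: (kernel s t) (kernel s tau) => p q [a b] /=; ring.
Qed.

End laplace_derivative_delay.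

(** * The Laplace transform of state-space systems *)

Section laplace_vector.
Variables (R : realType) (s : R[i]).

Definition laplace_cv n (x : R -> 'cV[R]_n) : 'cV[R[i]]_n :=
  \col_i laplace (fun t => x t i 0) s.

Definition laplace_cv_converges n (x : R -> 'cV[R]_n) : Prop :=
  forall i, laplace_converges (fun t => x t i 0) s.

Lemma laplace_cv_mulmx m n (M : 'M[R]_(m, n)) (x : R -> 'cV[R]_n) :
  laplace_cv_converges x ->
  laplace_cv_converges (fun t => M *m x t) /\
  laplace_cv (fun t => M *m x t) = cplx_mx M *m laplace_cv x.
Proof.
move=> xs; have lin i := laplace_lincomb (M i) xs; split=> [i|].
  by apply: eq_laplace_converges (lin i).1 => t _; rewrite mxE.
apply/matrixP => i j; rewrite !mxE.
transitivity (laplace (fun t => \sum_k M i k * x t k 0) s).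
  by apply: eq_laplace => t _; rewrite mxE.
by rewrite (lin i).2; apply: eq_bigr => k _; rewrite !mxE.
Qed.

Lemma laplace_cvD n (x y : R -> 'cV[R]_n) :
  laplace_cv_converges x -> laplace_cv_converges y ->
  laplace_cv_converges (fun t => x t + y t) /\
  laplace_cv (fun t => x t + y t) = laplace_cv x + laplace_cv y.
Proof.
move=> xs ys; split=> [i|].
  by apply: eq_laplace_converges (laplace_convergesD (xs i) (ys i)) => t _;
    rewrite mxE.
apply/matrixP => i j; rewrite !mxE -laplaceD//.
by apply: eq_laplace => t _; rewrite mxE.
Qed.

Lemma laplace_cv_input n (p : R -> R) (B : 'cV[R]_n) :
  laplace_converges p s ->
  laplace_cv_converges (fun t => p t *: B) /\
  laplace_cv (fun t => p t *: B) = laplace p s *: cplx_mx B.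
Proof.
move=> ps; split=> [i|].
  by apply: eq_laplace_converges (laplace_convergesZ (B i 0) ps) => t _;
    rewrite mxE mulrC.
apply/matrixP => i j; rewrite !mxE ord1 mulrC -laplaceZ//.
by apply: eq_laplace => t _; rewrite mxE mulrC.
Qed.

Lemma laplace_cv_from_rest n (x f : R -> 'cV[R]_n) :
  solves_from_rest x f -> laplace_cv_converges x -> laplace_cv_converges f ->
  laplace_cv f = s *: laplace_cv x.
Proof.
move=> xf xs fs; apply/matrixP => i j; rewrite !mxE.
by apply: laplace_from_rest => // t t0; have [] := xf t t0 i.
Qed.

(** The transform of the state solves (sI - A) X = P(s) B + Q(s) E. *)
Lemma laplace_output n (A : 'M[R]_n) (B E : 'cV[R]_n) (C : 'rV[R]_n)
    (p q : R -> R) (x : R -> 'cV[R]_n) :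
  solves_from_rest x (fun t => A *m x t + p t *: B + q t *: E) ->
  char_mx_at A s \in unitmx ->
  laplace_converges p s -> laplace_converges q s -> laplace_cv_converges x ->
  laplace (fun t => (C *m x t) 0 0) s =
  transfer A B C s * laplace p s + transfer A E C s * laplace q s.
Proof.
move=> xf Au ps qs xs.
have [Axs AxE] := laplace_cv_mulmx A xs.
have [Bs BE] := laplace_cv_input B ps; have [Es EE] := laplace_cv_input E qs.
have [ABs ABE] := laplace_cvD Axs Bs; have [fs fE] := laplace_cvD ABs Es.
have := laplace_cv_from_rest xf xs fs.
rewrite fE ABE AxE BE EE -addrA => sX.
have X : char_mx_at A s *m laplace_cv x =
    laplace p s *: cplx_mx B + laplace q s *: cplx_mx E.
  by rewrite mulmxBl mul_scalar_mx -sX [X in X - _]addrC addrK.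
move: X => /(canRL (mulKmx Au)) X.
have [_ /matrixP/(_ 0 0)] := laplace_cv_mulmx C xs.
rewrite mxE => ->; rewrite X /transfer mulmxDr -!scalemxAr mulmxDr -!scalemxAr.
by rewrite !mulmxA !mxE mulrC [X in _ + X]mulrC.
Qed.

End laplace_vector.

(** * Transfer functions of the augmented system *)

Section augmented.
Variables (R : realType) (n N : nat) (A : 'M[R]_n) (C : 'rV[R]_n).
Variables (AN : 'M[R]_N) (BN : 'cV[R]_N) (CN : 'rV[R]_N) (DN : R) (s : R[i]).
Hypotheses (Au : char_mx_at A s \in unitmx) (ANu : char_mx_at AN s \in unitmx).

Lemma char_mx_at_aug : char_mx_at (A_aug A C AN BN) s =
  block_mx (char_mx_at A s) 0 (- (cplx_mx BN *m cplx_mx C)) (char_mx_at AN s).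
Proof.
rewrite /char_mx_at /cplx_mx /A_aug map_block_mx map_mx0 map_mxM.
by rewrite scalar_mx_block opp_block_mx add_block_mx oppr0 addr0 !add0r.
Qed.

Lemma char_mx_at_aug_unit : char_mx_at (A_aug A C AN BN) s \in unitmx.
Proof. by rewrite char_mx_at_aug unitmxE det_lblock unitrM -!unitmxE Au. Qed.

(** Block forward substitution: the first block of the state responds to b1 as
    the plant does, and its output z drives the second block through BN; adding
    the feedthrough DN z gives the factor CN (sI - AN)^-1 BN + DN of z. *)
Lemma transfer_aug (b1 : 'cV[R]_n) (b2 : 'cV[R]_N) :
  transfer (A_aug A C AN BN) (col_mx b1 b2) (C_aug C CN DN) s =
  (transfer AN BN CN s + DN%:C) * transfer A b1 C s + transfer AN b2 CN s.
Proof.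
pose v1 := invmx (char_mx_at A s) *m cplx_mx b1.
pose z : R[i] := transfer A b1 C s.
pose v2 := invmx (char_mx_at AN s) *m (z *: cplx_mx BN + cplx_mx b2).
have zE : cplx_mx C *m v1 = z%:M.
  by rewrite [LHS]mx11_scalar /z /transfer mulmxA.
have sol : char_mx_at (A_aug A C AN BN) s *m col_mx v1 v2 =
    cplx_mx (col_mx b1 b2).
  rewrite char_mx_at_aug mul_block_col mul0mx addr0 /cplx_mx map_col_mx -!/(cplx_mx _).
  rewrite mulKVmx// mulKVmx// mulNmx -mulmxA zE mul_mx_scalar.
  by rewrite addKr.
rewrite {1}/transfer -mulmxA -sol mulKmx ?char_mx_at_aug_unit//.
rewrite /C_aug /cplx_mx map_row_mx map_mxZ mul_row_col -scalemxAl -!/(cplx_mx _).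
rewrite zE /v2 mulmxA mulmxDr -scalemxAr.
have entry (a : R[i]) (M1 M2 : 'M[R[i]]_1) :
    (a *: z%:M + (z *: M1 + M2)) 0 0 = a * z + (z * M1 0 0 + M2 0 0).
  by rewrite !mxE eqxx mulr1n.
rewrite entry.
by rewrite -/z -/(transfer AN BN CN s) -/(transfer AN b2 CN s); ring.
Qed.

End augmented.

(** * The estimation error *)

(** Substituting what into wtilde = w - what gives
    (1 + loop) wtilde = w - open - loop * noise, and
    (1 + loop)^-1 - 1 = - loop / (1 + loop). *)
Lemma feedback_error (F : fieldType) (w wtilde what loop open noise : F) :
  1 + loop != 0 -> wtilde = w - what -> what = open + loop * (wtilde + noise) ->
  wtilde = (1 + loop)^-1 * (w - open) + ((1 + loop)^-1 - 1) * noise.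
Proof.
move=> loop1 wtE whatE; apply: (mulfI loop1).
have -> : (1 + loop) * wtilde = w - open - loop * noise.
  by rewrite mulrDl mul1r {1}wtE whatE; ring.
by field.
Qed.

Theorem mainTheorem3 (R : realType) (n N : nat) (hn : (0 < n)%N) (hN : (0 < N)%N)
  (tau : R) (htau : 0 < tau)
  (* plant *)
  (A : 'M[R]_n) (B E : 'cV[R]_n) (C : 'rV[R]_n)
  (hobs : observable A C) (hctrB : controllable A B) (hctrE : controllable A E)
  (* Pade approximation *)
  (AN : 'M[R]_N) (BN : 'cV[R]_N) (CN : 'rV[R]_N) (DN : R)
  (hpade : minimal_pade_realization N tau AN BN CN DN)
  (* gains *)
  (L1 : 'cV[R]_n) (L2 : 'cV[R]_N) (K : 'rV[R]_n) (H : R)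
  (* signals: input, disturbance, measurement noise, reference, plant output,
     plant state, observer state *)
  (u d noise r y : R -> R) (x : R -> 'cV[R]_n) (xhat_aug : R -> 'cV[R]_(n + N)) :
  let w := fun t => y (t - tau) in
  let wm := fun t => w t + noise t in
  let what := fun t => (C_aug C CN DN *m xhat_aug t) 0 0 in
  let wtilde := fun t => w t - what t in
  let wtildem := fun t => wm t - what t in
  (* plant, observer and control law, from zero initial conditions *)
  solves_from_rest x (fun t => A *m x t + u t *: B + d t *: E) ->
  (forall t, 0 <= t -> y t = (C *m x t) 0 0) ->
  (forall t, t < 0 -> y t = 0) ->
  solves_from_rest xhat_aug
    (fun t => A_aug A C AN BN *m xhat_aug t + u t *: B_aug N B
              + wtildem t *: L_aug L1 L2) ->
  (forall t, 0 <= t -> u t = - (K *m usubmx (xhat_aug t)) 0 0 + H * r t) ->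
  let P := pade N tau in
  let G := transfer A B C in
  let Gd := transfer A E C in
  let Lest := L_est_aug A C AN BN CN DN L1 L2 in
  let Fbar := tradeoff_filter A C AN BN CN DN L1 L2 in
  let delay := fun s : R[i] => cexp (- (s * tau%:C)) in
  let Delta := fun s => delay s - P s in
  forall s : R[i],
  (* s is not a pole of the transfer functions involved *)
  char_mx_at A s \in unitmx ->
  char_mx_at AN s \in unitmx ->
  pade_den_at N tau s != 0 ->
  [/\ Lest s = P s * transfer A L1 C s + transfer AN L2 CN s,
      (* the Laplace transforms of the signals exist at s *)
      laplace_converges u s -> laplace_converges d s ->
      laplace_converges noise s ->
      (forall i, laplace_converges (fun t => x t i 0) s) ->
      (forall i, laplace_converges (fun t => xhat_aug t i 0) s) ->
      laplace what s
        = transfer (A_aug A C AN BN) (B_aug N B) (C_aug C CN DN) s * laplace u s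
          + Lest s * laplace wtildem s
    & laplace_converges u s -> laplace_converges d s ->
      laplace_converges noise s ->
      (forall i, laplace_converges (fun t => x t i 0) s) ->
      (forall i, laplace_converges (fun t => xhat_aug t i 0) s) ->
      1 + Lest s != 0 ->
      laplace wtilde s
        = Fbar s * (Delta s * G s * laplace u s
                    + delay s * Gd s * laplace d s)
          + (Fbar s - 1) * laplace noise s].

Proof.
move=> w wm what wtilde wtildem plant yE y0 observer control.
move=> P G Gd Lest Fbar delay Delta s Au ANu Qs.
have PE : P s = transfer AN BN CN s + DN%:C by exact: hpade.1.
have LestE : Lest s = P s * transfer A L1 C s + transfer AN L2 CN s.
  by rewrite PE; exact: transfer_aug.
have signals : laplace_converges u s -> laplace_converges d s ->
    laplace_converges noise s ->
    (forall i, laplace_converges (fun t => x t i 0) s) ->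
    (forall i, laplace_converges (fun t => xhat_aug t i 0) s) ->
    [/\ laplace_converges w s, laplace_converges what s,
        laplace_converges wtilde s, laplace_converges wtildem s
      & laplace w s = delay s * (G s * laplace u s + Gd s * laplace d s)].
  move=> us ds ns xs xhats.
  have yCx t : 0 <= t -> (C *m x t) 0 0 = y t by move=> /yE.
  have ys : laplace_converges y s.
    exact: eq_laplace_converges yCx ((laplace_cv_mulmx C xs).1 0).
  have ws : laplace_converges w s by exact: laplace_converges_delay (ltW htau) y0 ys.
  have whats : laplace_converges what s := (laplace_cv_mulmx _ xhats).1 0.
  have wts : laplace_converges wtilde s.
    apply: eq_laplace_converges (laplace_convergesD ws (laplace_convergesZ (-1) whats)).
    by move=> t _; rewrite mulN1r.
  split=> //.
    apply: eq_laplace_converges (laplace_convergesD wts ns) => t _.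
    by rewrite /wtilde /wtildem /wm addrAC.
  rewrite /w laplace_delay ?(ltW htau)//; congr (_ * _).
  by rewrite -(eq_laplace s yCx) (laplace_output C plant).
have whatE : laplace_converges u s -> laplace_converges d s ->
    laplace_converges noise s ->
    (forall i, laplace_converges (fun t => x t i 0) s) ->
    (forall i, laplace_converges (fun t => xhat_aug t i 0) s) ->
    laplace what s
      = transfer (A_aug A C AN BN) (B_aug N B) (C_aug C CN DN) s * laplace u s
        + Lest s * laplace wtildem s.
  move=> us ds ns xs xhats; have [_ _ _ wtms _] := signals us ds ns xs xhats.
  by apply: laplace_output observer _ us wtms xhats; exact: char_mx_at_aug_unit.
split=> // us ds ns xs xhats Lest1.
have [ws whats wts wtms wE] := signals us ds ns xs xhats.
have := whatE us ds ns xs xhats.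
rewrite {1}/B_aug transfer_aug// -PE.
have -> : transfer AN 0 CN s = 0.
  by rewrite /transfer /cplx_mx map_mx0 mulmx0 mxE.
have -> : laplace wtildem s = laplace wtilde s + laplace noise s.
  rewrite -laplaceD//; apply: eq_laplace => t _.
  by rewrite /wtilde /wtildem /wm addrAC.
have wtE : laplace wtilde s = laplace w s - laplace what s.
  have -> : - laplace what s = (-1)%:C * laplace what s by rewrite rmorphN1 mulN1r.
  rewrite -laplaceZ// -laplaceD//; last exact: laplace_convergesZ.
  by apply: eq_laplace => t _; rewrite mulN1r.
rewrite addr0 => whatEu; rewrite (feedback_error Lest1 wtE whatEu) wE.
rewrite /Fbar /tradeoff_filter -/(Lest s) /Delta -/(G s); congr (_ * _ + _); ring.
Qed.
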